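(* Let $W$ be a binary erasure channel with erasure probability $z\in[0,1)$. For $\varepsilon\in(0,1)$ such that $n:=-5\log_2\varepsilon$ is a positive integer, let $\mathcal T=\mathcal T(W,\varepsilon)$ be the channel tree generated from the root $W$ by the rule: apply the channel transformation $T$ to a vertex $w$ (i.e. give $w$ the two children $w^\flat$ and $w^\sharp$) if and only if $\operatorname{depth}(w)<n$ and $Y(w)>\varepsilon 2^{-n}$; and let $\mathcal A$ be the set of leaves $w$ of $\mathcal T$ with $Z(w)\le\varepsilon2^{-n}$. Then the per-bit time complexity of the resulting code is $O(\log|\log\varepsilon|)$ as $\varepsilon\to0$; that is, there are constants $C>0$ and $\varepsilon_0\in(0,1)$ (which may depend on $W$) such that for all $\varepsilon\in(0,\varepsilon_0)$ with $-5\log_2\varepsilon$ an integer, the per-bit time complexity is at most $C\log|\log\varepsilon|$.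
   Context: For a binary erasure channel $w$, let $Z(w)\in[0,1]$ denote its erasure probability (its Bhattacharyya parameter) and $Y(w)=\min\{Z(w),1-Z(w)\}$. The channel transformation $T$ turns two independent copies of $w$ into one copy of $w^\flat$ and one copy of $w^\sharp$, which are binary erasure channels with $Z(w^\flat)=1-(1-Z(w))^2$ and $Z(w^\sharp)=Z(w)^2$. A channel tree is a finite rooted full binary tree (each vertex has zero or two children) whose vertices are labelled by channels, such that the children of every non-leaf vertex $w$ are $w^\flat$ and $w^\sharp$. The root has depth $0$; $\operatorname{depth}(w)$ is the distance of $w$ from the root; the depth of a tree is the depth of its deepest leaf. Different vertices are regarded as distinct even if their labels have equal erasure probabilities. A channel tree $\mathcal T$ with root $W$ generates a circuit consuming $N=2^{\operatorname{depth}(\mathcal T)}$ copies of $W$. At a vertex $w$ there are $2^{\operatorname{depth}(\mathcal T)-\operatorname{depth}(w)}$ copies of the channel $w$; if $w$ is not a leaf, these copies are grouped into pairs, and each pair is transformed into a $w^\flat$ and a $w^\sharp$ by means of two magic devices (one encoding device and one decoding device). Hence the number of magic devices is $\sum_{w\text{ non-leaf}}2^{\operatorname{depth}(\mathcal T)-\operatorname{depth}(w)}=N\,\mathbb E[\tau]$, where $\tau$ is the depth of the random leaf $K_\tau$ reached by starting at the root and repeatedly moving to one of the two children with probability $1/2$ each until a leaf is reached. Given a set $\mathcal A$ of leaves, information bits are sent through the copies of the leaf channels in $\mathcal A$ and the fixed symbol $0$ through the copies of the other leaf channels. The code rate is $R=\mathbb P\{K_\tau\in\mathcal A\}$, so that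 a block carries $NR$ information bits. Devices are executed sequentially (no parallelism), each taking constant time, so the per-block time complexity (encoding and decoding) is taken to be a fixed constant times the number of magic devices. The per-bit time complexity is the per-block time complexity divided by the number $NR$ of information bits. *)

(* Defs.v *)
From HB Require Import structures.
From mathcomp Require Import all_boot all_order all_algebra.
From mathcomp Require Import reals exp.
From mathcomp Require Import ring lra.

Set Implicit Arguments.
Unset Strict Implicit.
Unset Printing Implicit Defensive.

Import Order.TTheory GRing.Theory Num.Theory.
Local Open Scope ring_scope.

(* A binary erasure channel is determined by its erasure probability. *)
Record bec (R : realType) := Bec {
  becZ : R;
  becZ_itv : 0 <= becZ <= 1 }.

Definition becY (R : realType) (w : bec R) : R := Num.min (becZ w) (1 - becZ w).

Fact flat_itv (R : realType) (w : bec R) : 0 <= 1 - (1 - becZ w) ^+ 2 <= 1.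
Proof. case: w => z /= /andP[z0 z1]; apply/andP; split; nra. Qed.

Fact sharp_itv (R : realType) (w : bec R) : 0 <= becZ w ^+ 2 <= 1.
Proof. case: w => z /= /andP[z0 z1]; apply/andP; split; nra. Qed.

Definition flat (R : realType) (w : bec R) : bec R := Bec (flat_itv w).
Definition sharp (R : realType) (w : bec R) : bec R := Bec (sharp_itv w).

(* [ctree w]: the channel trees with root [w]; the labels of all the other
   vertices are forced by the parameter. *)
Inductive ctree (R : realType) (w : bec R) : Type :=
| Leaf
| Node of ctree (flat w) & ctree (sharp w).
Arguments Leaf {R w}.

(* A vertex is the path from the root to it ([false]: to the flat child, [true]:
   to the sharp child) together with its label. The path tells apart vertices
   with equal labels. *)
Definition vertex (R : realType) : Type := (seq bool * bec R)%type.

Definition depth (R : realType) (v : vertex R) : nat := size v.1.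

Definition below (R : realType) (b : bool) (v : vertex R) : vertex R :=
  (b :: v.1, v.2).

Fixpoint leaves (R : realType) (w : bec R) (t : ctree w) : seq (vertex R) :=
  match t with
  | Leaf => [:: ([::], w)]
  | Node l r => map (below false) (leaves l) ++ map (below true) (leaves r)
  end.

Fixpoint nonleaves (R : realType) (w : bec R) (t : ctree w) : seq (vertex R) :=
  match t with
  | Leaf => [::]
  | Node l r => ([::], w) ::
      map (below false) (nonleaves l) ++ map (below true) (nonleaves r)
  end.

Definition tree_depth (R : realType) (w : bec R) (t : ctree w) : nat :=
  \max_(v <- leaves t) depth v.

Definition block_length (R : realType) (w : bec R) (t : ctree w) : nat :=
  2 ^ tree_depth t.

(* The copies of the channel at a non-leaf [v] form
   [2 ^ (tree_depth t - depth v) / 2] pairs, with two devices for each pair. *)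
Definition magic_devices (R : realType) (w : bec R) (t : ctree w) : nat :=
  \sum_(v <- nonleaves t) 2 ^ (tree_depth t - depth v).

(* The expectation of [f] at the leaf reached from the root by moving to either
   child with probability 1/2 until a leaf is met. *)
Fixpoint leaf_expectation (R : realType) (w : bec R) (t : ctree w)
    (f : vertex R -> R) : R :=
  match t with
  | Leaf => f ([::], w)
  | Node l r =>
      2^-1 * leaf_expectation l (fun v => f (below false v)) +
      2^-1 * leaf_expectation r (fun v => f (below true v))
  end.

(* [A] represents a set of leaves; its values off the leaves of [t] are
   irrelevant. *)
Definition code_rate (R : realType) (w : bec R) (t : ctree w)
    (A : pred (vertex R)) : R :=
  leaf_expectation t (fun v => (A v)%:R).

Definition info_bits (R : realType) (w : bec R) (t : ctree w)
    (A : pred (vertex R)) : R :=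
  (block_length t)%:R * code_rate t A.

(* [c] is the time charged to one device. *)
Definition block_time (R : realType) (c : R) (w : bec R) (t : ctree w) : R :=
  c * (magic_devices t)%:R.

(* By the convention [x / 0 = 0] this is meaningful only if [0 < info_bits t A]. *)
Definition bit_time (R : realType) (c : R) (w : bec R) (t : ctree w)
    (A : pred (vertex R)) : R :=
  block_time c t / info_bits t A.

(* The first argument is the remaining depth: a vertex of depth [d] of
   [pruned_tree n theta W] is treated by a call with first argument [n - d].
   [pruned_tree_rule] states the resulting rule in terms of [depth]. *)
Fixpoint pruned_tree (R : realType) (n : nat) (theta : R) (w : bec R) : ctree w :=
  match n with
  | 0%N => Leaf
  | m.+1 =>
      if theta < becY w then
        Node (pruned_tree m theta (flat w)) (pruned_tree m theta (sharp w))
      else Leaf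
  end.

Definition good_leaf (R : realType) (theta : R) : pred (vertex R) :=
  fun v => becZ v.2 <= theta.

Definition log2 (R : realType) (x : R) : R := ln x / ln 2.

Lemma pruned_tree_rule (R : realType) (n : nat) (theta : R) (w : bec R) :
  let splits (v : vertex R) := (depth v < n)%N && (theta < becY v.2) in
  all splits (nonleaves (pruned_tree n theta w)) /\
  all (predC splits) (leaves (pruned_tree n theta w)).
Proof.
elim: n w => [//|n IH] w /=.
case: ifPn => [hY|hY] /=; last by rewrite (negbTE hY).
have [nf lf] := IH (flat w); have [ns ls] := IH (sharp w).
rewrite hY !all_cat !all_map; split; apply/andP; split => //.
by apply/andP; split; [exact: nf | exact: ns].
Qed.

Lemma leaf_expectationE (R : realType) (w : bec R) (t : ctree w)
    (f : vertex R -> R) :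
  leaf_expectation t f = \sum_(v <- leaves t) f v / 2 ^+ depth v.
Proof.
elim: t f => [{}w|{}w l IHl r IHr] f /=; first by rewrite big_seq1 expr0 divr1.
rewrite big_cat !big_map /= IHl IHr !mulr_sumr; congr (_ + _);
  by apply: eq_bigr => v _; rewrite /depth /= exprS invfM mulrCA.
Qed.

Lemma magic_devicesE (R : realType) (w : bec R) (t : ctree w) :
  (magic_devices t)%:R =
  (block_length t)%:R * leaf_expectation t (fun v => (depth v)%:R).
Proof.
have scaleE (w' : bec R) (s : ctree w') f g a b :
    (forall v, f v = a + b * g v) ->
    leaf_expectation s f = a + b * leaf_expectation s g.
  elim: s f g => [{}w'|{}w' l IHl r IHr] f g fg /=; first exact: fg.
  rewrite (IHl _ (fun v => g (below false v))) => [|v]; last exact: fg.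
  rewrite (IHr _ (fun v => g (below true v))) => [|v]; last exact: fg.
  by field.
have aux k : (tree_depth t <= k)%N ->
    (\sum_(v <- nonleaves t) 2 ^ (k - depth v))%N%:R =
    2 ^+ k * leaf_expectation t (fun v => (depth v)%:R) :> R.
  elim: t k => [{}w|{}w l IHl r IHr] k; rewrite /tree_depth /=.
    by rewrite big_nil mulr0.
  rewrite big_cat !big_map geq_max => /andP[dl dr].
  have ne (w' : bec R) (s : ctree w') : (0 < size (leaves s))%N.
    by elim: s => [{}w'|{}w' l' IHl' r' _] //=; rewrite size_cat size_map ltn_addr.
  case: k dl dr => [|k] dl dr.
    by case: (leaves l) (ne _ l) dl => //= v s _; rewrite big_cons geq_max.
  have pred_max s b : (\max_(v <- s) depth (below b v) <= k.+1)%N ->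
      (\max_(v <- s) depth (v : vertex R) <= k)%N.
    elim: s => [|u s IHs]; first by rewrite !big_nil.
    by rewrite !big_cons !geq_max => /andP[du /IHs ->]; rewrite andbT.
  rewrite big_cons big_cat !big_map /= subn0 !natrD.
  rewrite (IHl k) ?(IHr k) ?(pred_max _ _ dl) ?(pred_max _ _ dr) //.
  have shiftE (w' : bec R) (s : ctree w') b :
      leaf_expectation s (fun v => (depth (below b v))%:R) =
      1 + 1 * leaf_expectation s (fun v => (depth v)%:R).
    by apply: scaleE => v; rewrite mul1r -[1]/(1%:R) -natrD.
  by rewrite !shiftE natrX exprS; field.
by rewrite aux // natrX.
Qed.

(* Main.v *)
(* With l = - ln (Z (1 - Z)), both children of a channel satisfy l' <= 2 l, and
   l_flat * l_sharp >= (5/4) l^2. So ln l grows on average by ln (5/4) / 2 at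
   every step of the random path, while at the leaves it is at most
   ln (2 ln (2 / theta)) = O(ln |ln eps|); hence the expected depth E of the
   reached leaf is O(ln |ln eps|). The erasure probability is a martingale along
   the path, and a leaf that is neither good nor nearly useless has depth n, which
   has probability at most E / n; hence the rate is at least
   1 - Z(W) - theta - E / n, which tends to 1 - Z(W). *)
Require Import Defs.
From mathcomp Require Import all_boot all_order all_algebra.
From mathcomp Require Import reals sequences exp.
From mathcomp Require Import ring lra.
Import Order.TTheory GRing.Theory Num.Theory.
Local Open Scope ring_scope.

(** * Growth of the potential in one step *)

(** Serves the case [q > 1] of [ln_growth_half], in the form [p * q ^+ 2 <= 5 / 8]. A chord on
    [0, 1/2] and a tangent at 3/10 replace two factors by linear ones. *)
Lemma sharp_flat_sq_le (R : realType) (z : R) : 0 <= z -> 2 * z <= 1 ->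
  z * (1 + z) * ((1 - z) * (2 - z)) ^+ 2 <= 5 / 8.
Proof.
move=> z0 z1.
have h1 : (1 - z) * (2 - z) <= 2 - 5 / 2 * z by nra.
have h2 : (1 + z) * ((1 - z) * (2 - z)) <= 2135 / 1000 - 19 / 10 * z.
  have h : z * z * z <= z * z / 2 by have := mulr_ge0 z0 z0; nra.
  by have := sqr_ge0 (z - 3 / 10); nra.
have h3 : z * ((2 - 5 / 2 * z) * (2135 / 1000 - 19 / 10 * z)) <= 5 / 8.
  by have := sqr_ge0 (z - 3 / 10); nra.
apply: le_trans h3.
have -> : z * (1 + z) * ((1 - z) * (2 - z)) ^+ 2 =
  z * (((1 - z) * (2 - z)) * ((1 + z) * ((1 - z) * (2 - z)))) by ring.
apply: ler_wpM2l => //.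
by apply: ler_pM => //; apply: mulr_ge0; nra.
Qed.

Lemma lnMp {R : realType} (x y : R) : 0 < x -> 0 < y -> ln (x * y) = ln x + ln y.
Proof. by move=> x0 y0; rewrite lnM ?posrE. Qed.

Lemma ln_mono {R : realType} (x y : R) : 0 < x -> x <= y -> ln x <= ln y.
Proof. by move=> x0 xy; rewrite ler_ln ?posrE // (lt_le_trans x0). Qed.

Lemma ln_le_sub1 {R : realType} (x : R) : 0 < x -> ln x <= x - 1.
Proof.
move=> x0; have := @le_ln1Dx R (x - 1); rewrite addrCA subrr addr0.
by apply; lra.
Qed.

Lemma ln_quarter_le {R : realType} : ln (1 / 4 : R) <= - 1.
Proof.
have -> : 1 / 4 = (1 / 2) * (1 / 2) :> R by lra.
by rewrite lnMp; try lra; have := @ln_le_sub1 R (1 / 2); lra.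
Qed.

(** Passing to the sharp or flat child multiplies [u = z (1 - z)] by [p] or [q]. Expanding the
    product, [ln u * (ln p + ln q) + ln p * ln q] must supply a quarter of the square of [ln u]. *)
Lemma ln_growth_half (R : realType) (z : R) : 0 < z -> 2 * z <= 1 ->
  5 / 4 * ln (z * (1 - z)) ^+ 2 <=
  ln (z * (1 - z) * (z * (1 + z))) * ln (z * (1 - z) * ((1 - z) * (2 - z))).
Proof.
move=> z0 z1; set u := z * (1 - z).
have u0 : 0 < u by apply: mulr_gt0; lra.
have u4 : u <= 1 / 4 by have := sqr_ge0 (z - 1 / 2); rewrite /u; nra.
set p := z * (1 + z); set q := (1 - z) * (2 - z).
have p0 : 0 < p by apply: mulr_gt0; lra.
have q0 : 0 < q by apply: mulr_gt0; lra.
rewrite (lnMp u p) // (lnMp u q) //.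
have lu : ln u <= - 1 by apply: le_trans ln_quarter_le; apply: ln_mono.
have lu0 : ln u <= 0 by lra.
have up : ln u <= ln p by apply: ln_mono => //; rewrite /u /p; nra.
have p1 : ln p <= 0 by apply: ln_le0; rewrite /p; nra.
(* If [q <= 1], both [ln p] and [ln q] are nonpositive and only their sum is
   needed. Otherwise [ln p * ln q] is negative and is bounded through
   [ln u <= ln p]. *)
case: (lerP q 1) => hq.
  have q1 : ln q <= 0 by apply: ln_le0.
  have pq : p * q <= u * (9 / 4).
    have -> : p * q = u * ((1 + z) * (2 - z)) by rewrite /p /q /u; ring.
    by apply: ler_wpM2l; [exact: ltW | have := sqr_ge0 (z - 1 / 2); nra].
  (* As (9/4)^5 <= 4^3 and [u <= 1 / 4], [ln (9 / 4)] is at most -3/5 [ln u]; this leaves the 2/5 of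
     [hs], more than the 1/4 needed. *)
  have h94 : 5 * ln (9 / 4 : R) + 3 * ln (1 / 4 : R) <= 0.
    rewrite !mulr_natl -!lnXn; try lra.
    rewrite -lnMp; try by apply: exprn_gt0; lra.
    by apply: ln_le0; lra.
  have lu4 : ln u <= ln (1 / 4 : R) by apply: ln_mono.
  have : ln (p * q) <= ln (u * (9 / 4)) by apply: ln_mono => //; apply: mulr_gt0.
  rewrite (lnMp p) // (lnMp u) //; last lra.
  move=> hpq.
  have hs : ln p + ln q <= 2 / 5 * ln u by lra.
  have hpq0 := mulr_le0 p1 q1; have hu := sqr_ge0 (ln u).
  have : ln u * (2 / 5 * ln u) <= ln u * (ln p + ln q) by rewrite ler_wnM2l.
  move: hu hpq0.
  generalize (ln u) (ln p) (ln q) => x y t; lra.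
have q1 : 0 < ln q by apply: ln_gt0.
(* Equivalent to [(p * q ^+ 2) ^+ 4 <= u]: one factor [p * q ^+ 2] supplies [u], and the rest is at
   most (5/8)^3 * 4 = 125/128. *)
have hpq : 4 * (ln p + 2 * ln q) <= ln u.
  have pq2 : 0 < p * q ^+ 2 by apply: mulr_gt0 => //; apply: exprn_gt0.
  rewrite !mulr_natl -lnXn // -lnMp ?exprn_gt0 // -lnXn //.
  apply: ln_mono; first exact: exprn_gt0.
  have h := sharp_flat_sq_le R z (ltW z0) z1.
  have -> : (p * q ^+ 2) ^+ 4 =
    u * ((p * q ^+ 2) ^+ 3 * ((1 + z) * ((1 - z) * (2 - z) ^+ 2))).
    by rewrite /p /q /u; ring.
  rewrite -[leRHS]mulr1; apply: ler_wpM2l; first exact: ltW.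
  have h3 : (p * q ^+ 2) ^+ 3 <= (5 / 8) ^+ 3.
    by apply: lerXn2r; rewrite ?nnegrE ?(ltW pq2) //; lra.
  have h4 : (1 + z) * ((1 - z) * (2 - z) ^+ 2) <= 4.
    have : 0 <= z * z * z by rewrite !mulr_ge0 // ltW.
    by nra.
  have h5 : 0 <= (1 + z) * ((1 - z) * (2 - z) ^+ 2).
    by rewrite !mulr_ge0 ?sqr_ge0 //; lra.
  apply: (@le_trans _ _ ((5 / 8) ^+ 3 * 4)); last lra.
  by apply: ler_pM => //; apply: exprn_ge0; apply: ltW.
have : ln u * ln u <= ln u * (4 * (ln p + 2 * ln q)) by rewrite ler_wnM2l.
have : ln u * ln q <= ln p * ln q by rewrite ler_wpM2r // ltW.
generalize (ln u) (ln p) (ln q) => x y t; lra.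
Qed.

Definition potential {R : realType} (w : bec R) : R :=
  - ln (becZ w * (1 - becZ w)).

Lemma potential_ge1 {R : realType} (w : bec R) : 0 < becZ w < 1 ->
  1 <= potential w.
Proof.
move=> /andP[z0 z1]; rewrite /potential lerNr.
apply: le_trans ln_quarter_le; apply: ln_mono; first by apply: mulr_gt0; lra.
by have := sqr_ge0 (becZ w - 1 / 2); nra.
Qed.

Lemma potential_growth {R : realType} (w : bec R) : 0 < becZ w < 1 ->
  5 / 4 * potential w ^+ 2 <= potential (flat w) * potential (sharp w).
Proof.
rewrite /potential /=; set z := becZ w => /andP[z0 z1]; rewrite sqrrN mulrNN.
case: (lerP (2 * z) 1) => hz.
  apply: le_trans (ln_growth_half R z z0 hz) _.
  rewrite mulrC le_eqVlt; apply/orP; left; apply/eqP.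
  by congr (ln _ * ln _); ring.
(* The reflection z -> 1 - z exchanges the two children and preserves the potential. *)
have -> : z * (1 - z) = (1 - z) * (1 - (1 - z)) by ring.
apply: le_trans (ln_growth_half R (1 - z) _ _) _; try lra.
rewrite le_eqVlt; apply/orP; left; apply/eqP.
by congr (ln _ * ln _); ring.
Qed.

(** The multiplier [(1 - z) * (2 - z)] of [u = z (1 - z)] is at least [u], because [z <= 2 - z]. *)
Lemma potential_flat_le {R : realType} (w : bec R) : 0 < becZ w < 1 ->
  potential (flat w) <= 2 * potential w.
Proof.
rewrite /potential /=; set z := becZ w => /andP[z0 z1].
have u0 : 0 < z * (1 - z) by apply: mulr_gt0; lra.
rewrite mulrN lerN2 mulr_natl -lnXn //; apply: ln_mono; first exact: exprn_gt0.
have -> : (1 - (1 - z) ^+ 2) * (1 - (1 - (1 - z) ^+ 2)) =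
  z * (1 - z) * ((1 - z) * (2 - z)) by ring.
by rewrite expr2 ler_wpM2l ?(ltW u0) //; nra.
Qed.

Lemma potential_sharp_le {R : realType} (w : bec R) : 0 < becZ w < 1 ->
  potential (sharp w) <= 2 * potential w.
Proof.
rewrite /potential /=; set z := becZ w => /andP[z0 z1].
have u0 : 0 < z * (1 - z) by apply: mulr_gt0; lra.
rewrite mulrN lerN2 mulr_natl -lnXn //; apply: ln_mono; first exact: exprn_gt0.
have -> : z ^+ 2 * (1 - z ^+ 2) = z * (1 - z) * (z * (1 + z)) by ring.
by rewrite expr2 ler_wpM2l ?(ltW u0) //; nra.
Qed.

Lemma ltY_inner {R : realType} (theta : R) (w : bec R) :
  0 < theta -> theta < becY w -> 0 < becZ w < 1.
Proof.
by rewrite /becY lt_min => t0 /andP[h1 h2]; apply/andP; split; lra.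
Qed.

(** Both Z and 1 - Z exceed [theta], and the larger is at least 1/2. *)
Lemma ltY_potential_le {R : realType} (theta : R) (w : bec R) :
  0 < theta -> theta < becY w -> potential w <= - ln (theta / 2).
Proof.
move=> t0; rewrite /becY /potential lt_min => /andP[h1 h2].
rewrite lerN2; apply: ln_mono; first lra.
by case: (lerP (2 * becZ w) 1) => h; nra.
Qed.

(** * Expectations over the random leaf and its depth *)

Lemma leaf_expectation_affine {R : realType} (w : bec R) (t : ctree w)
    (a b : R) (f g : vertex R -> R) :
  leaf_expectation t (fun v => a * f v + b * g v) =
  a * leaf_expectation t f + b * leaf_expectation t g.
Proof.
elim: t f g => [{}w|{}w l IHl r IHr] f g //=.
by rewrite IHl IHr; ring.
Qed.

Lemma leaf_expectation_cst {R : realType} (w : bec R) (t : ctree w) (a : R) :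
  leaf_expectation t (fun=> a) = a.
Proof. by elim: t => [//|{}w l IHl r IHr] /=; rewrite IHl IHr; lra. Qed.

(** The predicate [P] lets the stopping rule at the leaves enter a comparison. *)
Lemma le_leaf_expectation {R : realType} (w : bec R) (t : ctree w)
    (P : pred (vertex R)) (f g : vertex R -> R) :
  (forall v, P v -> f v <= g v) -> all P (leaves t) ->
  leaf_expectation t f <= leaf_expectation t g.
Proof.
elim: t P f g => [{}w|{}w l IHl r IHr] P f g fg /=.
  by rewrite andbT => /fg.
rewrite all_cat !all_map => /andP[Pl Pr]; apply: lerD; rewrite ler_wpM2l ?invr_ge0 //.
- by apply: IHl Pl => v; apply: fg.
- by apply: IHr Pr => v; apply: fg.
Qed.

Lemma leaf_expectation_depth_below {R : realType} (w : bec R) (t : ctree w)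
    (b : bool) :
  leaf_expectation t (fun v => (depth (below b v))%:R) =
  1 + leaf_expectation t (fun v => (depth v)%:R).
Proof.
have affE := leaf_expectation_affine w t 1 1 (fun=> 1) (fun v => (depth v)%:R).
rewrite !mul1r leaf_expectation_cst in affE; rewrite -affE.
(* Two pointwise inequalities stand in for function extensionality. *)
apply/le_anti/andP; split; apply: (le_leaf_expectation w t predT); try exact: all_predT.
all: by move=> v _; rewrite !mul1r /depth /= -natr1 addrC.
Qed.

(** The budget [M - ln (potential w)] pays for the mean drift at each split. Only split vertices
    have potential at most [- ln (theta / 2)]; their children may reach twice that, hence the factor
    2 in the bound on [M]. *)
Lemma pruned_tree_expected_depth_le {R : realType} (n : nat) (theta M : R)
    (w : bec R) : 0 < theta -> ln (2 * - ln (theta / 2)) <= M ->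
  0 < becZ w < 1 -> ln (potential w) <= M ->
  ln (5 / 4) / 2 * leaf_expectation (pruned_tree n theta w) (fun v => (depth v)%:R)
    + ln (potential w) <= M.
Proof.
move=> t0 hM; elim: n w => [|n IH] w hw wM /=; first by rewrite mulr0 add0r.
case: ifPn => [hY|_] /=; last by rewrite mulr0 add0r.
rewrite !leaf_expectation_depth_below.
have hf : 0 < becZ (flat w) < 1.
  by case/andP: hw => z0 z1 /=; apply/andP; split; nra.
have hs : 0 < becZ (sharp w) < 1.
  by case/andP: hw => z0 z1 /=; apply/andP; split; nra.
have pw := ltY_potential_le theta w t0 hY.
have p1 := potential_ge1 w hw.
have pf1 := potential_ge1 _ hf; have ps1 := potential_ge1 _ hs.
have pf2 := potential_flat_le w hw; have ps2 := potential_sharp_le w hw.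
have Mf : ln (potential (flat w)) <= M.
  by apply: le_trans hM; apply: ln_mono; lra.
have Ms : ln (potential (sharp w)) <= M.
  by apply: le_trans hM; apply: ln_mono; lra.
have := IH _ hf Mf; have := IH _ hs Ms.
have : ln (5 / 4) + 2 * ln (potential w) <=
    ln (potential (flat w)) + ln (potential (sharp w)).
  rewrite -lnMp ?(lt_le_trans ltr01) //.
  rewrite (mulr_natl (ln (potential w))) -lnXn; last lra.
  rewrite -lnMp; try by [lra | apply: exprn_gt0; lra].
  apply: ln_mono (potential_growth w hw).
  by apply: mulr_gt0; [lra | apply: exprn_gt0; lra].
lra.
Qed.

(** * Code rate *)

Lemma leaf_expectation_erasure {R : realType} (w : bec R) (t : ctree w) :
  leaf_expectation t (fun v => becZ v.2) = becZ w.
Proof. by elim: t => [//|{}w l IHl r IHr] /=; rewrite IHl IHr /=; field. Qed.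

Lemma pruned_tree_code_rate_ge {R : realType} (n : nat) (theta : R) (w : bec R) :
  (0 < n)%N -> 0 <= theta ->
  1 - becZ w - theta - n%:R^-1 *
    leaf_expectation (pruned_tree n theta w) (fun v => (depth v)%:R) <=
  code_rate (pruned_tree n theta w) (good_leaf theta).
Proof.
move=> n0 t0; set t := pruned_tree n theta w.
have [_ tP] := pruned_tree_rule n theta w.
(* At depth [n] the depth term is at least 1. At any other leaf Y is at most [theta]: either the
   leaf is good, or its Z is at least [1 - theta]. *)
have leP (v : vertex R) : ~~ ((depth v < n)%N && (theta < becY v.2)) ->
    1 - theta <=
    1 * (good_leaf theta v)%:R + 1 * (1 * becZ v.2 + n%:R^-1 * (depth v)%:R).
  have /andP[Z0 Z1] := becZ_itv v.2.
  have d0 : 0 <= n%:R^-1 * (depth v)%:R :> R by rewrite mulr_ge0 ?invr_ge0.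
  rewrite /good_leaf negb_and -leqNgt /becY => /orP[dn|].
    have : 1 <= n%:R^-1 * (depth v)%:R :> R.
      by rewrite mulrC ler_pdivlMr ?ltr0n // mul1r ler_nat.
    by case: (becZ v.2 <= theta) => /=; lra.
  by rewrite -leNgt ge_min; case: (becZ v.2 <= theta) => /= h; lra.
have := le_leaf_expectation w t _ _ _ leP tP.
rewrite leaf_expectation_cst !leaf_expectation_affine leaf_expectation_erasure.
by rewrite /code_rate; lra.
Qed.

(** * Constants and asymptotics in [eps] *)

Lemma ln_le_2sqrt {R : realType} (x : R) : 0 < x -> ln x <= 2 * Num.sqrt x.
Proof.
move=> x0; have s0 : 0 < Num.sqrt x by rewrite sqrtr_gt0.
have -> : ln x = 2 * ln (Num.sqrt x).
  by rewrite mulr_natl -lnXn // sqr_sqrtr // ltW.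
by rewrite ler_wpM2l // ltW // ln_sublinear.
Qed.

Theorem proposition6 (R : realType) (W : bec R) (hW : becZ W < 1)
    (c : R) (hc : 0 < c) :
  exists C eps0 : R, [/\ 0 < C, 0 < eps0 < 1 &
    forall (eps : R) (n : nat), 0 < eps < eps0 -> n%:R = - 5 * log2 eps ->
      let T := pruned_tree n (eps / 2 ^+ n) W in
      let A := good_leaf (eps / 2 ^+ n) in
      0 < info_bits T A /\ bit_time c T A <= C * ln `|ln eps|].
Proof.
have /andP[Z0 _] := becZ_itv W.
set d : R := ln (5 / 4) / 2.
have d0 : 0 < d by apply: divr_gt0 => //; apply: ln_gt0; lra.
(* With [s = sqrt L], the rate loses at most 1/s from [theta] and [d^-1 / s] from [E / n]. *)
pose K := 1 + d^-1.
have di : 0 < d^-1 by rewrite invr_gt0.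
(* The 14 gives 2 (6 L + ln 2) <= L^2; the square makes the loss [K / s] at most half of
   [1 - becZ W]. *)
pose L0 := 14 + (2 * K / (1 - becZ W)) ^+ 2.
have L0_14 : 14 <= L0 by rewrite /L0 lerDl sqr_ge0.
(* This constant is [c] times the depth factor [2 / d], divided by the rate bound
   [(1 - becZ W) / 2]. *)
have C0 : 0 < 4 * c / d / (1 - becZ W).
  by apply: divr_gt0; [apply: divr_gt0 => //; lra | lra].
exists (4 * c / d / (1 - becZ W)), (expR (- L0)); split => //.
- by rewrite expR_gt0 expR_lt1; lra.
move=> eps n /andP[e0 e1] nE T A.
set L := - ln eps.
have LL0 : L0 < L.
  by rewrite /L ltrNr -ltr_expR lnK ?posrE.
have ln2_gt0 : 0 < ln (2 : R) by apply: ln_gt0; lra.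
have ln2_le1 : ln (2 : R) <= 1 by have := @ln_le_sub1 R 2; lra.
have nL : n%:R * ln 2 = 5 * L :> R.
  by rewrite nE /log2 /L; field; rewrite gt_eqF.
have n5L : 5 * L <= n%:R by rewrite -nL ler_piMr.
have n0 : (0 < n)%N by rewrite -(ltr0n R); lra.
set theta := eps / 2 ^+ n in T A *.
have p0 : 0 < 2 ^+ n :> R by rewrite exprn_gt0.
have t0 : 0 < theta by rewrite divr_gt0.
have lnt : - ln (theta / 2) = 6 * L + ln 2.
  rewrite ln_div ?posrE // ln_div ?posrE // lnXn // -(mulr_natl (ln 2)) nL /L.
  by ring.
have lnthL : ln (2 * - ln (theta / 2)) <= 2 * ln L.
  rewrite (mulr_natl (ln L)) -lnXn ?lnt; last lra.
  apply: ln_mono; first lra.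
  have : 14 * L <= L ^+ 2 by rewrite expr2 ler_wpM2r //; lra.
  by lra.
have lnL0 : 0 <= ln L by apply: ln_ge0; lra.
pose E := leaf_expectation T (fun v => (depth v)%:R).
have dE : d * E <= 2 * ln L.
  (* An unsplit root, such as one with Z = 0, has depth 0; a split one has 0 < Z < 1, as the
     potential argument requires. *)
  case: (ltrP theta (becY W)) => hY; last first.
    have -> : E = 0.
      by rewrite /E /T; case: (n) => [//|m] /=; rewrite ltNge hY.
    by rewrite mulr0 mulr_ge0.
  have hW' := ltY_inner theta W t0 hY.
  have p1 := potential_ge1 W hW'.
  have pw := ltY_potential_le theta W t0 hY.
  have lp : 0 <= ln (potential W) by apply: ln_ge0.
  have lpM : ln (potential W) <= 2 * ln L.
    by apply: le_trans lnthL; apply: ln_mono; lra.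
  have := pruned_tree_expected_depth_le n theta (2 * ln L) W t0 lnthL hW' lpM.
  by rewrite -/T -/E -/d; lra.
have EL : E <= 2 * d^-1 * ln L.
  by rewrite mulrAC ler_pdivlMr // mulrC.
pose s := Num.sqrt L.
have s2 : s * s = L by rewrite -expr2 sqr_sqrtr; lra.
have s0 : 0 < s by rewrite sqrtr_gt0; lra.
have L_gt0 : 0 < L by lra.
have sK : K / s <= (1 - becZ W) / 2.
  have z0 : 0 < 1 - becZ W by lra.
  have k0 : 0 < K by rewrite /K; lra.
  have : 2 * K / (1 - becZ W) <= s.
    rewrite -(@ler_pXn2r _ 2) ?nnegrE ?(ltW s0) //; last first.
      by rewrite divr_ge0 ?mulr_ge0 // ltW.
    by rewrite [leRHS]expr2 s2; move: LL0; rewrite /L0; lra.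
  rewrite ler_pdivrMr // ler_pdivrMr //; lra.
have theta_s : theta <= s^-1.
  have s1 : 1 <= s by nra.
  have te : theta <= eps.
    by rewrite ler_pdivrMr // ler_peMr ?(ltW e0) // exprn_ege1 //; lra.
  have eL : L <= eps^-1.
    have := expR_ge1Dx L; rewrite /L expRN lnK ?posrE //; lra.
  apply: le_trans te _; rewrite -[leLHS]invrK lef_pV2 ?posrE ?invr_gt0 //.
  by apply: le_trans eL; rewrite -s2 ler_peMr // ltW.
(* From [ln L <= 2 s] and [n >= 5 L], the ratio is at most 4/5 of [d^-1 / s]. *)
have nE_s : n%:R^-1 * E <= d^-1 / s.
  have nR : 0 < n%:R :> R by rewrite ltr0n.
  have := ln_le_2sqrt L L_gt0; rewrite -/s => lns.
  rewrite mulrC ler_pdivrMr // mulrAC ler_pdivlMr //.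
  have h1 : E * s <= 2 * d^-1 * ln L * s by rewrite ler_wpM2r // ltW.
  have h2 : d^-1 * (ln L * s) <= d^-1 * (2 * (s * s)).
    by rewrite ler_wpM2l ?(ltW di) // mulrA ler_wpM2r // ltW.
  have h3 : d^-1 * (5 * L) <= d^-1 * n%:R by rewrite ler_wpM2l // ltW.
  have h4 : 0 < d^-1 * L by rewrite mulr_gt0.
  by rewrite s2 in h2; lra.
have rate : (1 - becZ W) / 2 <= code_rate T A.
  have := pruned_tree_code_rate_ge n theta W n0 (ltW t0); rewrite -/T -/A -/E.
  by move: sK; rewrite /K mulrDl mul1r; lra.
have r0 : 0 < code_rate T A by lra.
have N0 : 0 < (block_length T)%:R :> R by rewrite ltr0n expn_gt0.
split; first by rewrite mulr_gt0.
rewrite /bit_time /block_time /info_bits magic_devicesE -/E.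
have -> : c * ((block_length T)%:R * E) / ((block_length T)%:R * code_rate T A)
  = c * E / code_rate T A by field; rewrite !gt_eqF.
have -> : `|ln eps| = L by rewrite ler0_norm //; move: L_gt0; rewrite /L; lra.
rewrite ler_pdivrMr //.
have z0 : 0 < 1 - becZ W by lra.
apply: (@le_trans _ _ (c * (2 * d^-1 * ln L))); first by rewrite ler_pM2l.
have -> : c * (2 * d^-1 * ln L) =
  4 * c / d / (1 - becZ W) * ln L * ((1 - becZ W) / 2) by field; lra.
by rewrite ler_wpM2l // mulr_ge0 // ltW.
Qed.
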